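(* The satisfiability problem for Strategy Logic (SL) is highly undecidable; in particular, it is $\Sigma^1_1$-hard. That is, deciding, for a given SL sentence $\varphi$, whether there exists a concurrent game structure $G$ with $G\models\varphi$ is $\Sigma^1_1$-hard.
   Context: A concurrent game structure (CGS) is a tuple $G=(\mathrm{AP},\mathrm{Ag},\mathrm{Ac},\mathrm{St},\lambda,\tau,s_0)$ where $\mathrm{AP}$ and $\mathrm{Ag}$ are finite non-empty sets of atomic propositions and agents, $\mathrm{Ac}$ and $\mathrm{St}$ are countable non-empty sets of actions and states, $s_0\in\mathrm{St}$ is the initial state, $\lambda:\mathrm{St}\to 2^{\mathrm{AP}}$ is a labeling, and $\tau:\mathrm{St}\times\mathrm{Dc}\to\mathrm{St}$ is the transition function, where $\mathrm{Dc}=\mathrm{Ac}^{\mathrm{Ag}}$ is the set of decisions. A track (resp. path) is a non-empty finite (resp. infinite) sequence of states $\rho$ such that for every $i$, $\rho_{i+1}=\tau(\rho_i,\delta)$ for some decision $\delta$. A strategy is a function from tracks to $\mathrm{Ac}$. Given a set $\mathrm{Var}$ of variables, an assignment is a partial function $\chi$ from $\mathrm{Var}\cup\mathrm{Ag}$ to strategies; it is complete if it is defined on all agents; $\chi[l\mapsto f]$ agrees with $\chi$ except that it maps $l$ to $f$. For a complete $\chi$ and a state $s$, $\mathrm{play}(\chi,s)$ is the path $\pi$ with $\pi_0=s$ and $\pi_{i+1}=\tau(\pi_i,\delta_i)$ where $\delta_i(a)=\chi(a)(\pi_0\cdots\pi_i)$. The $i$-th translation $(\chi,s)^i$ is the pair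 $(\chi',\pi_i)$ where $\chi'(l)(\rho)=\chi(l)(\pi_0\cdots\pi_{i-1}\cdot\rho)$ for all $l$ in the domain of $\chi$ and tracks $\rho$ starting at $\pi_i$. SL formulas: $\varphi::=p\mid\neg\varphi\mid\varphi\wedge\varphi\mid\varphi\vee\varphi\mid \mathsf{X}\varphi\mid\varphi\,\mathsf{U}\,\varphi\mid\varphi\,\mathsf{R}\,\varphi\mid\langle\langle x\rangle\rangle\varphi\mid[\![x]\!]\varphi\mid(a,x)\varphi$ with $p\in\mathrm{AP}$, $x\in\mathrm{Var}$, $a\in\mathrm{Ag}$. Free agents/variables: $\mathrm{free}(p)=\emptyset$; $\mathrm{free}(\neg\varphi)=\mathrm{free}(\varphi)$; $\mathrm{free}(\varphi_1\wedge\varphi_2)=\mathrm{free}(\varphi_1\vee\varphi_2)=\mathrm{free}(\varphi_1)\cup\mathrm{free}(\varphi_2)$; $\mathrm{free}(\mathsf{X}\varphi)=\mathrm{Ag}\cup\mathrm{free}(\varphi)$; $\mathrm{free}(\varphi_1\mathsf{U}\varphi_2)=\mathrm{free}(\varphi_1\mathsf{R}\varphi_2)=\mathrm{Ag}\cup\mathrm{free}(\varphi_1)\cup\mathrm{free}(\varphi_2)$; $\mathrm{free}(\langle\langle x\rangle\rangle\varphi)=\mathrm{free}([\![x]\!]\varphi)=\mathrm{free}(\varphi)\setminus\{x\}$; $\mathrm{free}((a,x)\varphi)=\mathrm{free}(\varphi)$ if $a\notin\mathrm{free}(\varphi)$ and $(\mathrm{free}(\varphi)\setminus\{a\})\cup\{x\}$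 otherwise. A sentence has no free agents or variables. Semantics, for $\mathrm{free}(\varphi)\subseteq\mathrm{dom}(\chi)$: $G,\chi,s\models p$ iff $p\in\lambda(s)$; Boolean connectives as usual; $G,\chi,s\models\langle\langle x\rangle\rangle\varphi$ iff for some strategy $f$, $G,\chi[x\mapsto f],s\models\varphi$; $[\![x]\!]$ dually with ''for all''; $G,\chi,s\models(a,x)\varphi$ iff $G,\chi[a\mapsto\chi(x)],s\models\varphi$; for complete $\chi$: $\mathsf{X}\varphi$ holds iff $G,(\chi,s)^1\models\varphi$; $\varphi_1\mathsf{U}\varphi_2$ iff there is $i$ with $G,(\chi,s)^i\models\varphi_2$ and $G,(\chi,s)^j\models\varphi_1$ for all $j<i$; $\varphi_1\mathsf{R}\varphi_2$ iff for all $i$, $G,(\chi,s)^i\models\varphi_2$ or $G,(\chi,s)^j\models\varphi_1$ for some $j<i$. $G\models\varphi$ iff $G,\emptyset,s_0\models\varphi$ ($\emptyset$ the empty assignment); $\varphi$ is satisfiable iff it has a model. *)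

(* Defs.v *)
From HB Require Import structures.
From mathcomp Require Import all_boot.

Set Implicit Arguments.
Unset Strict Implicit.
Unset Printing Implicit Defensive.

(* Strategy variables are natural numbers. *)
Inductive sl (AP Ag : Type) : Type :=
| Atom of AP
| Neg of sl AP Ag
| And of sl AP Ag & sl AP Ag
| Or of sl AP Ag & sl AP Ag
| Next of sl AP Ag
| Until of sl AP Ag & sl AP Ag
| Release of sl AP Ag & sl AP Ag
| ExStr of nat & sl AP Ag
| AllStr of nat & sl AP Ag
| Bind of Ag & nat & sl AP Ag.

Arguments Atom {AP Ag} _.

(* [inl a] is the agent a, [inr x] the variable x. *)
Fixpoint free (AP : Type) (Ag : eqType) (phi : sl AP Ag) (l : Ag + nat) : bool :=
  match phi with
  | Atom _ => false
  | Neg phi1 => free phi1 l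
  | And phi1 phi2 | Or phi1 phi2 => free phi1 l || free phi2 l
  | Next phi1 => is_inl l || free phi1 l
  | Until phi1 phi2 | Release phi1 phi2 =>
      [|| is_inl l, free phi1 l | free phi2 l]
  | ExStr x phi1 | AllStr x phi1 => free phi1 l && (l != inr x)
  | Bind a x phi1 =>
      if free phi1 (inl a) then free phi1 l && (l != inl a) || (l == inr x)
      else free phi1 l
  end.

Definition sentence (AP : Type) (Ag : eqType) (phi : sl AP Ag) : Prop :=
  forall l, ~~ free phi l.

Record cgs (AP Ag : finType) := CGS {
  Ac : countType;
  St : countType;
  ac0 : Ac; (* non-emptiness of the set of actions *)
  lab : St -> {set AP};
  trans : St -> {ffun Ag -> Ac} -> St;
  init : St
}.

Section Semantics.

Variables (AP Ag : finType) (G : cgs AP Ag).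

Definition step (s t : St G) : Prop :=
  exists d : {ffun Ag -> Ac G}, t = trans s d.

Fixpoint linked (s : St G) (r : seq (St G)) : Prop :=
  if r is t :: r' then step s t /\ linked t r' else True.

(* The track first :: rest. *)
Record track := Track {
  first : St G;
  rest : seq (St G);
  trackP : linked first rest
}.

Definition tlast (rho : track) : St G := last (first rho) (rest rho).

Lemma linked_cat s r1 r2 :
  linked s (r1 ++ r2) <-> linked s r1 /\ linked (last s r1) r2.
Proof. elim: r1 s => [|t r1 IH] s /=; first tauto. have := IH t; tauto. Qed.

Lemma linked_glue (rho rho' : track) :
  first rho' = tlast rho -> linked (first rho) (rest rho ++ rest rho').
Proof.
move=> e; apply/linked_cat; split; first exact: trackP.
by rewrite -/(tlast rho) -e; exact: trackP.
Qed.

(* [glue] overlaps the last state of rho with the first state of rho'. *)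
Definition glue (rho rho' : track) (e : first rho' = tlast rho) : track :=
  Track (linked_glue e).

Definition track1 (s : St G) : track := @Track s [::] I.

Lemma linked_extend (rho : track) (d : {ffun Ag -> Ac G}) :
  linked (first rho) (rcons (rest rho) (trans (tlast rho) d)).
Proof.
rewrite -cats1; apply/linked_cat; split; first exact: trackP.
by split=> //; exists d.
Qed.

Definition extend (rho : track) (d : {ffun Ag -> Ac G}) : track :=
  Track (linked_extend rho d).

Definition strategy : Type := track -> Ac G.

Definition assignment : Type := Ag + nat -> option strategy.

(* Plays are only meaningful for complete assignments: the strategy used for an
   undefined agent is arbitrary. *)
Definition agent_strategy (chi : assignment) (a : Ag) : strategy :=
  odflt (fun=> ac0 G) (chi (inl a)).

(* [hist chi s i] is the prefix pi_0 ... pi_i of pi = play chi s. *)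
Fixpoint hist (chi : assignment) (s : St G) (i : nat) : track :=
  if i is j.+1 then
    let rho := hist chi s j in
    extend rho [ffun a => agent_strategy chi a rho]
  else track1 s.

Definition play (chi : assignment) (s : St G) (i : nat) : St G :=
  tlast (hist chi s i).

(* For rho = pi_0 ... pi_i and rho' starting at pi_i, [glue] is the track
   pi_0 ... pi_(i-1) . rho'.  On the other tracks the translated strategy is
   unspecified; its values there are never used, as it is only evaluated
   from pi_i. *)
Definition shift (rho : track) (f : strategy) : strategy :=
  fun rho' =>
    match first rho' =P tlast rho with
    | ReflectT e => f (glue e)
    | ReflectF _ => f rho'
    end.

Definition translate (chi : assignment) (s : St G) (i : nat) : assignment :=
  fun l => omap (shift (hist chi s i)) (chi l).

(* Meaningful when free phi is included in the domain of chi. *)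
Fixpoint sat (phi : sl AP Ag) (chi : assignment) (s : St G) : Prop :=
  match phi with
  | Atom p => p \in lab s
  | Neg phi1 => ~ sat phi1 chi s
  | And phi1 phi2 => sat phi1 chi s /\ sat phi2 chi s
  | Or phi1 phi2 => sat phi1 chi s \/ sat phi2 chi s
  | Next phi1 => sat phi1 (translate chi s 1) (play chi s 1)
  | Until phi1 phi2 =>
      exists i, sat phi2 (translate chi s i) (play chi s i) /\
        forall j, j < i -> sat phi1 (translate chi s j) (play chi s j)
  | Release phi1 phi2 =>
      forall i, sat phi2 (translate chi s i) (play chi s i) \/
        exists2 j, j < i & sat phi1 (translate chi s j) (play chi s j)
  | ExStr x phi1 =>
      exists f : strategy, sat phi1 [eta chi with inr x |-> Some f] s
  | AllStr x phi1 =>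
      forall f : strategy, sat phi1 [eta chi with inr x |-> Some f] s
  | Bind a x phi1 => sat phi1 [eta chi with inl a |-> chi (inr x)] s
  end.

Definition models (phi : sl AP Ag) : Prop := sat phi (fun=> None) (init G).

End Semantics.

Definition satisfiable (AP Ag : finType) (phi : sl AP Ag) : Prop :=
  exists G : cgs AP Ag, models G phi.

(* Cantor's pairing function. *)
Definition cpair (x y : nat) : nat := 'C((x + y).+1, 2) + y.

Lemma cpair_inj x y x' y' : cpair x y = cpair x' y' -> x = x' /\ y = y'.
Proof.
have lt_cpair a b c d : a + b < c + d -> cpair a b < cpair c d.
  move=> lt; rewrite /cpair.
  apply: (@leq_trans 'C((a + b).+2, 2)).
    by rewrite (binS (a + b).+1) bin1 ltn_add2l ltnS leq_addl.
  by apply: leq_trans (leq_addr _ _); rewrite leq_bin2l.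
move=> e; case: (ltngtP (x + y) (x' + y')) => [/lt_cpair|/lt_cpair|es].
- by rewrite e ltnn.
- by rewrite e ltnn.
move: e; rewrite /cpair es => /addnI ey; split=> //.
by move: es; rewrite ey => /addIn.
Qed.

Fixpoint code (p g : nat) (phi : sl 'I_p 'I_g) : nat :=
  match phi with
  | Atom q => cpair 0 q
  | Neg phi1 => cpair 1 (code phi1)
  | And phi1 phi2 => cpair 2 (cpair (code phi1) (code phi2))
  | Or phi1 phi2 => cpair 3 (cpair (code phi1) (code phi2))
  | Next phi1 => cpair 4 (code phi1)
  | Until phi1 phi2 => cpair 5 (cpair (code phi1) (code phi2))
  | Release phi1 phi2 => cpair 6 (cpair (code phi1) (code phi2))
  | ExStr x phi1 => cpair 7 (cpair x (code phi1))
  | AllStr x phi1 => cpair 8 (cpair x (code phi1))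
  | Bind a x phi1 => cpair 9 (cpair a (cpair x (code phi1)))
  end.

Lemma code_inj p g : injective (@code p g).
Proof.
elim=> [q|f IH|f1 IH1 f2 IH2|f1 IH1 f2 IH2|f IH|f1 IH1 f2 IH2|f1 IH1 f2 IH2
       |x f IH|x f IH|a x f IH];
case=> [q'|f'|f1' f2'|f1' f2'|f'|f1' f2'|f1' f2'|x' f'|x' f'|a' x' f'];
rewrite [code _]/= [RHS]/= => /cpair_inj [// _].
- by move/val_inj->.
- by move/IH->.
- by case/cpair_inj => /IH1-> /IH2->.
- by case/cpair_inj => /IH1-> /IH2->.
- by move/IH->.
- by case/cpair_inj => /IH1-> /IH2->.
- by case/cpair_inj => /IH1-> /IH2->.
- by case/cpair_inj => -> /IH->.
- by case/cpair_inj => -> /IH->.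
- by case/cpair_inj => /val_inj-> /cpair_inj [-> /IH->].
Qed.

(* An instance consists of non-empty finite sets AP = {0, ..., p} and
   Ag = {0, ..., g} and a sentence over them. *)
Definition SL_SAT (c : nat) : Prop :=
  exists (p g : nat) (phi : sl 'I_p.+1 'I_g.+1),
    [/\ c = cpair p (cpair g (code phi)), sentence phi & satisfiable phi].

(* Minimization is restricted to regular functions, so that only total
   functions are generated. *)
Inductive recursive : forall n : nat, (n.-tuple nat -> nat) -> Prop :=
| rec_zero n : recursive (fun _ : n.-tuple nat => 0)
| rec_succ : recursive (fun v : 1.-tuple nat => (thead v).+1)
| rec_proj n (i : 'I_n) : recursive (fun v : n.-tuple nat => tnth v i)
| rec_comp n m (h : m.-tuple nat -> nat) (g : 'I_m -> n.-tuple nat -> nat) :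
    recursive h -> (forall i, recursive (g i)) ->
    recursive (fun v : n.-tuple nat => h [tuple g i v | i < m])
| rec_prim n (g : n.-tuple nat -> nat) (h : n.+2.-tuple nat -> nat) :
    recursive g -> recursive h ->
    recursive (fun v : n.+1.-tuple nat =>
      let w : n.-tuple nat := [tuple of behead v] in
      iteri (thead v) (fun k y => h [tuple of k :: y :: w]) (g w))
| rec_min n (f : n.+1.-tuple nat -> nat)
    (regular : forall v : n.-tuple nat, exists y, f [tuple of y :: v] == 0) :
    recursive f -> recursive (fun v : n.-tuple nat => ex_minn (regular v))
| rec_ext n (f g : n.-tuple nat -> nat) :
    f =1 g -> recursive f -> recursive g.

Definition computable (f : nat -> nat) : Prop :=
  recursive (fun v : 1.-tuple nat => f (thead v)).

Definition many_one_reducible (A B : nat -> Prop) : Prop :=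
  exists f : nat -> nat, computable f /\ forall n, A n <-> B (f n).

Inductive term : Type :=
| Var of nat
| Zero
| One
| Add of term & term
| Mul of term & term.

(* Formulas of second-order arithmetic; number variables and set variables are
   two separate sorts, both named by natural numbers. *)
Inductive so : Type :=
| SoEq of term & term
| SoLt of term & term
| SoIn of term & nat
| SoNot of so
| SoAnd of so & so
| SoOr of so & so
| SoExNum of nat & so
| SoAllNum of nat & so
| SoExSet of nat & so
| SoAllSet of nat & so.

Fixpoint teval (e : nat -> nat) (t : term) : nat :=
  match t with
  | Var x => e x
  | Zero => 0
  | One => 1
  | Add t1 t2 => teval e t1 + teval e t2
  | Mul t1 t2 => teval e t1 * teval e t2
  end.

Fixpoint so_sat (e : nat -> nat) (V : nat -> nat -> Prop) (psi : so) : Prop :=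
  match psi with
  | SoEq t1 t2 => teval e t1 = teval e t2
  | SoLt t1 t2 => teval e t1 < teval e t2
  | SoIn t X => V X (teval e t)
  | SoNot psi1 => ~ so_sat e V psi1
  | SoAnd psi1 psi2 => so_sat e V psi1 /\ so_sat e V psi2
  | SoOr psi1 psi2 => so_sat e V psi1 \/ so_sat e V psi2
  | SoExNum x psi1 => exists k : nat, so_sat [eta e with x |-> k] V psi1
  | SoAllNum x psi1 => forall k : nat, so_sat [eta e with x |-> k] V psi1
  | SoExSet X psi1 =>
      exists S : nat -> Prop, so_sat e [eta V with X |-> S] psi1
  | SoAllSet X psi1 =>
      forall S : nat -> Prop, so_sat e [eta V with X |-> S] psi1
  end.

Fixpoint arithmetical (psi : so) : bool :=
  match psi with
  | SoEq _ _ | SoLt _ _ | SoIn _ _ => true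
  | SoNot psi1 | SoExNum _ psi1 | SoAllNum _ psi1 => arithmetical psi1
  | SoAnd psi1 psi2 | SoOr psi1 psi2 => arithmetical psi1 && arithmetical psi2
  | SoExSet _ _ | SoAllSet _ _ => false
  end.

Fixpoint Sigma11_formula (psi : so) : bool :=
  if psi is SoExSet _ psi1 then Sigma11_formula psi1 else arithmetical psi.

(* The number variable 0 stands for the element of A; quantifying over all
   valuations e and V excludes dependence on any parameter. *)
Definition Sigma11 (A : nat -> Prop) : Prop :=
  exists2 psi : so, Sigma11_formula psi &
    forall (e : nat -> nat) (V : nat -> nat -> Prop),
      A (e 0) <-> so_sat e V psi.

Definition Sigma11_hard (B : nat -> Prop) : Prop :=
  forall A : nat -> Prop, Sigma11 A -> many_one_reducible A B.

(* Main.v *)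
Require Import Defs.
From mathcomp Require Import all_boot zify boolp.

(* Only the temporal operator X is needed, with three agents. At the initial state
   s, an action n stands for the number named by the state diag s n reached when all
   agents play n, and a strategy f stands for the set of those n such that, if all
   agents switch to f in diag s n, the next state carries the label member_ap. So
   quantification over strategies is quantification over numbers and, independently,
   over arbitrary sets of numbers. Labels of the successors of s provide a unary, a
   binary and two ternary relations on actions; the second-order Peano axioms, stated
   as an SL formula, force them to be zero, successor, addition and multiplication
   on the standard natural numbers. Every formula of second-order arithmetic then
   translates into SL, and the parameter n enters through n nested copies of a
   formula incrementing a number variable, which makes the code computable in n. *)

Set Implicit Arguments.
Unset Strict Implicit.
Unset Printing Implicit Defensive.

(** * Agents, labels and the basic SL formulas *)

Definition ag0 : 'I_3 := @Ordinal 3 0 isT.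
Definition ag1 : 'I_3 := @Ordinal 3 1 isT.
Definition ag2 : 'I_3 := @Ordinal 3 2 isT.

Definition member_ap : 'I_5 := @Ordinal 5 0 isT.
Definition zero_ap : 'I_5 := @Ordinal 5 1 isT.
Definition succ_ap : 'I_5 := @Ordinal 5 2 isT.
Definition plus_ap : 'I_5 := @Ordinal 5 3 isT.
Definition times_ap : 'I_5 := @Ordinal 5 4 isT.

Notation formula := (sl 'I_5 'I_3).

Definition Imp (f1 f2 : formula) : formula := Or (Neg f1) f2.
Definition Iff (f1 f2 : formula) : formula := And (Imp f1 f2) (Imp f2 f1).
Definition joint x y z (f : formula) : formula :=
  Bind ag0 x (Bind ag1 y (Bind ag2 z (Next f))).
Definition isZero x : formula := joint x x x (Atom zero_ap).
Definition isSucc x y : formula := joint x y y (Atom succ_ap).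
Definition isPlus x y z : formula := joint x y z (Atom plus_ap).
Definition isTimes x y z : formula := joint x y z (Atom times_ap).
Definition member x f : formula := joint x x x (joint f f f (Atom member_ap)).
(* Leibniz equality; on states where member_ap can be both forced and avoided, it is
   equality of the states naming the two numbers. *)
Definition sameNum x y : formula :=
  let f := (x + y).+1 in AllStr f (Iff (member x f) (member y f)).

(** * Semantics of joint moves, membership and equality of numbers *)

Section Game.

Variable G : cgs 'I_5 'I_3.
Implicit Types (chi : assignment G) (s t : St G) (a b c n m : Ac G).

Definition decision a b c : {ffun 'I_3 -> Ac G} :=
  [ffun i : 'I_3 => nth a [:: a; b; c] i].

Definition next_state s a b c := trans s (decision a b c).
Definition diag s a := next_state s a a a.

(** The default is that of [agent_strategy], so binding an agent to an undefined variable needs no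
    separate treatment. *)
Definition strategy_of chi v : strategy G := odflt (fun=> ac0 G) (chi (inr v)).
Definition action_of chi s v : Ac G := strategy_of chi v (track1 s).

Definition upd chi v (f : strategy G) : assignment G :=
  [eta chi with inr v |-> Some f].

Definition moved chi s x y z : assignment G :=
  translate [eta [eta [eta chi with inl ag0 |-> chi (inr x)]
    with inl ag1 |-> chi (inr y)] with inl ag2 |-> chi (inr z)] s 1.

Definition track2 s n : track G := extend (track1 s) (decision n n n).

(** The answer of [f] is read on a two-state track, so it is independent of the action of [f] at
    [s]. The track depends on [n] only through [diag s n], so sets are sets of named states. *)
Definition holds s (f : strategy G) n : Prop :=
  member_ap \in lab (diag (diag s n) (f (track2 s n))).

(* The tracks met during translations carry different proofs of being linked. *)
Lemma track_ext (r r' : track G) : first r = first r' -> rest r = rest r' -> r = r'.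
Proof.
case: r r' => [a l p] [a' l' p'] /= ea el; rewrite ea el in p *.
by congr Track; exact: Prop_irrelevance.
Qed.

Lemma strategy_of_upd chi v f w :
  strategy_of (upd chi v f) w = if w == v then f else strategy_of chi w.
Proof. by rewrite /strategy_of /upd /= (inj_eq inr_inj); case: eqP. Qed.

Lemma action_of_upd chi s v f w :
  action_of (upd chi v f) s w = if w == v then f (track1 s) else action_of chi s w.
Proof. by rewrite /action_of strategy_of_upd; case: eqP. Qed.

Definition joint_decision chi s x y z :=
  decision (action_of chi s x) (action_of chi s y) (action_of chi s z).

Lemma joint_decisionE chi s x y z :
  [ffun a => agent_strategy [eta [eta [eta chi with inl ag0 |-> chi (inr x)]
    with inl ag1 |-> chi (inr y)] with inl ag2 |-> chi (inr z)] a (track1 s)] =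
  joint_decision chi s x y z.
Proof. by apply/ffunP; case=> [[|[|[|i]]] hi]; rewrite !ffunE. Qed.

Lemma sat_joint chi s x y z f :
  sat (joint x y z f) chi s =
  sat f (moved chi s x y z)
    (next_state s (action_of chi s x) (action_of chi s y) (action_of chi s z)).
Proof. by rewrite /joint /= /play /= joint_decisionE. Qed.

(** Translation by one step prepends [s], so at the new state the translated strategy acts as the
    original one does on the two-state track. *)
Lemma action_of_moved chi s x v :
  let t := diag s (action_of chi s x) in
  action_of (moved chi s x x x) t v = strategy_of chi v (track2 s (action_of chi s x)).
Proof.
rewrite /= /action_of /strategy_of /moved /translate /=.
case: (chi (inr v)) => //= f; rewrite /shift; case: eqP => [e|[]].
  congr f; apply: track_ext => //=; by rewrite joint_decisionE.
by rewrite /tlast /= joint_decisionE.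
Qed.


Lemma sat_atom3 p chi s x y z :
  sat (joint x y z (Atom p)) chi s =
  (p \in lab (next_state s (action_of chi s x) (action_of chi s y) (action_of chi s z))).
Proof. by rewrite sat_joint. Qed.

Lemma sat_And f1 f2 chi s : sat (And f1 f2) chi s = (sat f1 chi s /\ sat f2 chi s).
Proof. by []. Qed.

Lemma sat_Neg f chi s : sat (Neg f) chi s = ~ sat f chi s.
Proof. by []. Qed.

Lemma sat_Imp f1 f2 chi s : sat (Imp f1 f2) chi s = (sat f1 chi s -> sat f2 chi s).
Proof. by rewrite implyE. Qed.

Lemma sat_Iff f1 f2 chi s : sat (Iff f1 f2) chi s = (sat f1 chi s <-> sat f2 chi s).
Proof. by rewrite /Iff sat_And !sat_Imp. Qed.

Lemma sat_AllStr f chi s v : sat (AllStr v f) chi s = forall g, sat f (upd chi v g) s.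
Proof. by []. Qed.

Lemma sat_ExStr f chi s v : sat (ExStr v f) chi s = exists g, sat f (upd chi v g) s.
Proof. by []. Qed.

(** Constant strategies realize every action, so a strategy quantifier collapses to an action
    quantifier when only the action at [s] matters. *)
Lemma sat_AllStr_action f chi s v (P : Ac G -> Prop) :
  (forall g, sat f (upd chi v g) s = P (g (track1 s))) ->
  sat (AllStr v f) chi s = forall n, P n.
Proof.
move=> fP; rewrite sat_AllStr; apply: propext; split=> [H n|H g]; last by rewrite fP.
by have := H (fun=> n); rewrite fP.
Qed.

Lemma sat_ExStr_action f chi s v (P : Ac G -> Prop) :
  (forall g, sat f (upd chi v g) s = P (g (track1 s))) ->
  sat (ExStr v f) chi s = exists n, P n.
Proof.
move=> fP; rewrite sat_ExStr; apply: propext; split=> [[g]|[n Pn]].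
  by rewrite fP; exists (g (track1 s)).
by exists (fun=> n); rewrite fP.
Qed.

Lemma sat_member x f chi s :
  sat (member x f) chi s = holds s (strategy_of chi f) (action_of chi s x).
Proof. by rewrite /member sat_joint sat_atom3 /= action_of_moved. Qed.

Lemma holds_diag s f n m : diag s n = diag s m -> holds s f n -> holds s f m.
Proof.
move=> e; rewrite /holds e; suff -> : track2 s n = track2 s m by [].
by apply: track_ext => //=; move: e; rewrite /diag /next_state => ->.
Qed.

(** Being able both to force and to avoid [member_ap] lets strategies realize every set of named
    states. *)
Definition choice_axiom s := forall n,
  (exists c, member_ap \in lab (diag (diag s n) c)) /\
  (exists c, member_ap \notin lab (diag (diag s n) c)).

(** Choose for each state an action that forces or avoids [member_ap] as [P] demands; the strategy
    looks only at the last state of the track. *)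
Lemma comprehension s (P : St G -> Prop) :
  choice_axiom s -> exists f, forall n, holds s f n <-> P (diag s n).
Proof.
move=> Hs.
have [|g gP] := @choice (St G) (Ac G) (fun t c =>
    forall n, t = diag s n -> (member_ap \in lab (diag t c)) <-> P t).
  move=> t; case: (pselect (exists n, t = diag s n)) => [[n ->]|no]; last first.
    by exists (ac0 G) => n tn; case: no; exists n.
  have [[c1 H1] [c0 H0]] := Hs n.
  case: (pselect (P (diag s n))) => Pn; first by exists c1.
  by exists c0 => _ _; split=> // H; rewrite H in H0.
exists (fun r => g (tlast r)) => n.
exact: gP.
Qed.

Lemma sat_sameNum x y chi s : choice_axiom s ->
  sat (sameNum x y) chi s = (diag s (action_of chi s x) = diag s (action_of chi s y)).
Proof.
move=> Hs; rewrite /sameNum sat_AllStr; apply: propext.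
(* The bound variable of [sameNum] captures neither [x] nor [y]. *)
have nx : x == (x + y).+1 = false by apply/eqP; lia.
have ny : y == (x + y).+1 = false by apply/eqP; lia.
split=> [H|e g].
  (* The separating set is the singleton of the state named by [x]. *)
  have [g gP] := comprehension (eq (diag s (action_of chi s x))) Hs.
  move: (H g); rewrite sat_Iff !sat_member !strategy_of_upd !action_of_upd eqxx nx ny.
  by rewrite !gP => -[/(_ erefl)].
rewrite sat_Iff !sat_member !strategy_of_upd !action_of_upd eqxx nx ny.
by split; apply: holds_diag.
Qed.

End Game.

(** * Second-order Peano arithmetic and its categoricity *)

Section Arithmetic.

Variables (A B : Type) (T : A -> B).
Variables (zero : A -> Prop) (succ : A -> A -> Prop) (plus times : A -> A -> A -> Prop).

(** Elements of [A] count as equal when their images under [T] agree. Induction ranges over all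
    predicates on [B], which makes the system second-order. *)
Record arithmetic_axioms : Prop := ArithmeticAxioms {
  zero_ex : exists x, zero x;
  zero_un : forall x y, zero x -> (zero y <-> T x = T y);
  succ_ex : forall x, exists y, succ x y;
  succ_nz : forall x y, succ x y -> ~ zero y;
  succ_inj_fun : forall x y x' y', succ x y -> succ x' y' -> (T x = T x' <-> T y = T y');
  succ_ext : forall x y x' y', succ x y -> T x = T x' -> T y = T y' -> succ x' y';
  induction : forall P : B -> Prop, (forall x, zero x -> P (T x)) ->
    (forall x y, succ x y -> P (T x) -> P (T y)) -> forall x, P (T x);
  plus0 : forall x y z, zero y -> (plus x y z <-> T x = T z);
  plusS : forall x y y' z', succ y y' ->
    (plus x y' z' <-> exists z, plus x y z /\ succ z z');
  times0 : forall x y z, zero y -> (times x y z <-> zero z);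
  timesS : forall x y y' z', succ y y' ->
    (times x y' z' <-> exists z, times x y z /\ plus z x z')
}.

Record standard (num : A -> nat) : Prop := Standard {
  num_surj : forall k, exists x, num x = k;
  num_eq : forall x y, T x = T y <-> num x = num y;
  num_zero : forall x, zero x <-> num x = 0;
  num_succ : forall x y, succ x y <-> num y = (num x).+1;
  num_plus : forall x y z, plus x y z <-> num x + num y = num z;
  num_times : forall x y z, times x y z <-> num x * num y = num z
}.

Lemma standard_axioms num : standard num -> arithmetic_axioms.
Proof.
case=> sj eqn zn sn pn tn; split.
- exact: (let: ex_intro x xn := sj 0 in ex_intro _ x (proj2 (zn x) xn)).
- by move=> x y /zn xn; rewrite zn eqn xn; split=> ->.
- by move=> x; have [y yn] := sj (num x).+1; exists y; apply/sn.
- by move=> x y /sn yn /zn; rewrite yn.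
- by move=> x y x' y' /sn yn /sn yn'; rewrite !eqn yn yn'; split=> [->|[]].
- by move=> x y x' y' /sn yn /eqn xn /eqn yn'; apply/sn; rewrite -yn' -xn.
- move=> P P0 PS x; have [k kn] : exists k, num x = k by exists (num x).
  elim: k x kn => [|k IH] x kn; first by apply/P0/zn.
  by have [y yn] := sj k; apply: (PS y); [apply/sn; rewrite kn yn | apply: IH].
- by move=> x y z /zn yn; rewrite pn eqn yn addn0.
- move=> x y y' z' /sn yn; rewrite pn yn addnS; split=> [e|[z [/pn -> /sn]] //].
  by have [z zn'] := sj (num x + num y); exists z; rewrite pn sn zn'.
- by move=> x y z /zn yn; rewrite tn zn yn muln0; split.
- move=> x y y' z' /sn yn; rewrite tn yn mulnS; split=> [e|[z [/tn e /pn]]].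
    by have [z zn'] := sj (num x * num y); exists z; rewrite tn pn zn' addnC.
  by rewrite -e addnC.
Qed.

(** Dedekind's argument: the iterates of a chosen successor from a zero are pairwise distinct by the
    successor axioms and exhaust [A], up to [T], by induction. [num] gives the index of the matching
    iterate; the recursion equations then fix addition and multiplication by induction on the second
    argument. *)
Lemma axioms_standard : arithmetic_axioms -> exists num, standard num.
Proof.
case=> [[x0 z0]] z_un s_ex s_nz s_ij s_ext ind p0 pS t0 tS.
have [s sP] := choice s_ex.
pose a k := iter k s x0.
have aS k : succ (a k) (a k.+1) by exact: sP.
have a_inj j k : T (a j) = T (a k) -> j = k.
  elim: j k => [|j IH] [|k] //.
  - by move=> /(z_un _ _ z0) /(s_nz _ _ (aS k)).
  - by move=> /esym /(z_un _ _ z0) /(s_nz _ _ (aS j)).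
  - by move=> /(s_ij _ _ _ _ (aS j) (aS k)) /IH ->.
have a_surj x : exists k, T x = T (a k).
  apply: (ind (fun t => exists k, t = T (a k))) => {x} [x zx|x y xy [k xk]].
    by exists 0; apply/esym/(z_un _ _ z0).
  by exists k.+1; apply/(s_ij _ _ _ _ xy (aS k)).
have [num numP] := choice a_surj.
have num_eq x y : T x = T y <-> num x = num y.
  by rewrite (numP x) (numP y); split=> [/a_inj|->].
have num_zero x : zero x <-> num x = 0.
  rewrite (z_un _ _ z0) (numP x); split=> [/(@a_inj 0)|-> //]; by [].
have num_succ x y : succ x y <-> num y = (num x).+1.
  split=> [xy|e].
    by apply: a_inj; rewrite -numP; apply/(s_ij _ _ _ _ xy (aS _)).
  by apply: (s_ext _ _ _ _ (aS (num x))); rewrite -?numP // -e.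
have num_surj k : exists x, num x = k by exists (a k); apply: a_inj; rewrite -numP.
have num_plus x y z : plus x y z <-> num x + num y = num z.
  have [k ky] : exists k, num y = k by exists (num y).
  elim: k y z ky => [|k IH] y z ky.
    by rewrite p0 ?num_zero // ky addn0 num_eq.
  have [w wk] := num_surj k.
  have -> : num y = (num w).+1 by rewrite wk.
  rewrite (pS _ w) ?num_succ ?wk // addnS; split=> [[u [/IH-/(_ wk)]]|e].
    by rewrite wk => -> /num_succ.
  have [u uk] := num_surj (num x + k).
  by exists u; rewrite IH // num_succ uk wk.
exists num; split=> // x y z.
have [k ky] : exists k, num y = k by exists (num y).
elim: k y z ky => [|k IH] y z ky.
  by rewrite t0 ?num_zero // ky muln0; split.
have [w wk] := num_surj k.
have -> : num y = (num w).+1 by rewrite wk.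
rewrite (tS _ w) ?num_succ ?wk // mulnS addnC; split=> [[u [/IH-/(_ wk)]]|e].
  by rewrite wk => -> /num_plus.
have [u uk] := num_surj (num x * k).
by exists u; rewrite IH // num_plus uk wk.
Qed.

End Arithmetic.

(** * The axioms as SL formulas *)

(** The inner quantifiers stand after the move, so they choose an action at the state named by
    variable 0. *)
Definition choice_formula : formula :=
  AllStr 0 (joint 0 0 0 (And (ExStr 1 (joint 1 1 1 (Atom member_ap)))
    (ExStr 1 (joint 1 1 1 (Neg (Atom member_ap)))))).
Definition zero_ex_formula := ExStr 0 (isZero 0).
Definition zero_un_formula :=
  AllStr 0 (AllStr 1 (Imp (isZero 0) (Iff (isZero 1) (sameNum 0 1)))).
Definition succ_ex_formula := AllStr 0 (ExStr 1 (isSucc 0 1)).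
Definition succ_nz_formula :=
  AllStr 0 (AllStr 1 (Imp (isSucc 0 1) (Neg (isZero 1)))).
Definition succ_inj_fun_formula :=
  AllStr 0 (AllStr 1 (AllStr 2 (AllStr 3 (Imp (isSucc 0 1) (Imp (isSucc 2 3)
    (Iff (sameNum 0 2) (sameNum 1 3))))))).
Definition succ_ext_formula :=
  AllStr 0 (AllStr 1 (AllStr 2 (AllStr 3 (Imp (isSucc 0 1)
    (Imp (sameNum 0 2) (Imp (sameNum 1 3) (isSucc 2 3))))))).
(** Variable 2 is read as a set, variables 0 and 1 as numbers. *)
Definition induction_formula :=
  AllStr 2 (Imp (AllStr 0 (Imp (isZero 0) (member 0 2)))
    (Imp (AllStr 0 (AllStr 1 (Imp (isSucc 0 1) (Imp (member 0 2) (member 1 2)))))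
      (AllStr 0 (member 0 2)))).
Definition plus0_formula :=
  AllStr 0 (AllStr 1 (AllStr 2
    (Imp (isZero 1) (Iff (isPlus 0 1 2) (sameNum 0 2))))).
Definition plusS_formula :=
  AllStr 0 (AllStr 1 (AllStr 2 (AllStr 3 (Imp (isSucc 1 2)
    (Iff (isPlus 0 2 3) (ExStr 4 (And (isPlus 0 1 4) (isSucc 4 3)))))))).
Definition times0_formula :=
  AllStr 0 (AllStr 1 (AllStr 2
    (Imp (isZero 1) (Iff (isTimes 0 1 2) (isZero 2))))).
Definition timesS_formula :=
  AllStr 0 (AllStr 1 (AllStr 2 (AllStr 3 (Imp (isSucc 1 2)
    (Iff (isTimes 0 2 3) (ExStr 4 (And (isTimes 0 1 4) (isPlus 4 0 3)))))))).

Definition axioms_formula : formula :=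
  And choice_formula (And zero_ex_formula (And zero_un_formula
  (And succ_ex_formula (And succ_nz_formula (And succ_inj_fun_formula
  (And succ_ext_formula (And induction_formula (And plus0_formula
  (And plusS_formula (And times0_formula timesS_formula)))))))))).

(** * Translation of second-order arithmetic into SL *)

(* Number variables, set variables and the scratch variables used for the values of
   subterms are separated modulo 3. *)
Definition numv x := 3 * x.
Definition setv X := (3 * X).+1.
Definition tmpv d := (3 * d).+2.

(* [value t d] binds only scratch variables of index greater than d. *)
Fixpoint value (t : term) (d : nat) : formula :=
  match t with
  | Var x => sameNum (numv x) (tmpv d)
  | Zero => isZero (tmpv d)
  | One => ExStr (tmpv d.+1) (And (isZero (tmpv d.+1)) (isSucc (tmpv d.+1) (tmpv d)))
  | Add t1 t2 =>
      ExStr (tmpv d.+1) (And (value t1 d.+1) (ExStr (tmpv d.+2)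
        (And (value t2 d.+2) (isPlus (tmpv d.+1) (tmpv d.+2) (tmpv d)))))
  | Mul t1 t2 =>
      ExStr (tmpv d.+1) (And (value t1 d.+1) (ExStr (tmpv d.+2)
        (And (value t2 d.+2) (isTimes (tmpv d.+1) (tmpv d.+2) (tmpv d)))))
  end.

(** Terms in atoms are first evaluated into scratch variables. The strict order is expressed as the
    existence of a nonzero summand leading from the first value to the second. *)
Fixpoint translation (psi : so) : formula :=
  match psi with
  | SoEq t1 t2 => ExStr (tmpv 0) (And (value t1 0) (value t2 0))
  | SoLt t1 t2 =>
      ExStr (tmpv 0) (And (value t1 0) (ExStr (tmpv 1) (And (value t2 1)
        (ExStr (tmpv 2) (And (Neg (isZero (tmpv 2)))
          (isPlus (tmpv 0) (tmpv 2) (tmpv 1)))))))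
  | SoIn t X => ExStr (tmpv 0) (And (value t 0) (member (tmpv 0) (setv X)))
  | SoNot psi1 => Neg (translation psi1)
  | SoAnd psi1 psi2 => And (translation psi1) (translation psi2)
  | SoOr psi1 psi2 => Or (translation psi1) (translation psi2)
  | SoExNum x psi1 => ExStr (numv x) (translation psi1)
  | SoAllNum x psi1 => AllStr (numv x) (translation psi1)
  | SoExSet X psi1 => ExStr (setv X) (translation psi1)
  | SoAllSet X psi1 => AllStr (setv X) (translation psi1)
  end.

(** * Meaning of the axioms at a state *)

Section Interpretation.

Variables (G : cgs 'I_5 'I_3) (s : St G).
Implicit Types (chi : assignment G) (n m : Ac G).

Definition zero_at n : Prop := zero_ap \in lab (diag s n).
Definition succ_at n m : Prop := succ_ap \in lab (next_state s n m m).
Definition plus_at a b c : Prop := plus_ap \in lab (next_state s a b c).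
Definition times_at a b c : Prop := times_ap \in lab (next_state s a b c).

Definition arithmetic_at : Prop :=
  arithmetic_axioms (diag s) zero_at succ_at plus_at times_at.

Lemma sat_choice chi : sat choice_formula chi s = choice_axiom s.
Proof.
apply: sat_AllStr_action => g; rewrite sat_joint sat_And action_of_upd eqxx.
congr (_ /\ _); apply: sat_ExStr_action => h.
  by rewrite sat_atom3 !action_of_upd.
by rewrite sat_joint sat_Neg /= !action_of_upd; apply: propext; split=> /negP.
Qed.

Hypothesis choice_s : choice_axiom s.

Lemma sat_isZero x chi : sat (isZero x) chi s = zero_at (action_of chi s x).
Proof. exact: sat_atom3. Qed.
Lemma sat_isSucc x y chi :
  sat (isSucc x y) chi s = succ_at (action_of chi s x) (action_of chi s y).
Proof. exact: sat_atom3. Qed.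
Lemma sat_isPlus x y z chi : sat (isPlus x y z) chi s =
  plus_at (action_of chi s x) (action_of chi s y) (action_of chi s z).
Proof. exact: sat_atom3. Qed.
Lemma sat_isTimes x y z chi : sat (isTimes x y z) chi s =
  times_at (action_of chi s x) (action_of chi s y) (action_of chi s z).
Proof. exact: sat_atom3. Qed.

Let satE := (sat_And, sat_Neg, sat_Imp, sat_Iff, sat_isZero, sat_isSucc,
  sat_isPlus, sat_isTimes, sat_member, fun x y chi => sat_sameNum x y chi choice_s,
  action_of_upd, strategy_of_upd).

Lemma sat_zero_ex chi : sat zero_ex_formula chi s = exists x, zero_at x.
Proof. by apply: sat_ExStr_action => ?; rewrite !satE. Qed.

Lemma sat_zero_un chi : sat zero_un_formula chi s =
  forall x y, zero_at x -> (zero_at y <-> diag s x = diag s y).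
Proof. by do 2! apply: sat_AllStr_action => ?; rewrite !satE. Qed.

Lemma sat_succ_ex chi : sat succ_ex_formula chi s = forall x, exists y, succ_at x y.
Proof.
by apply: sat_AllStr_action => ?; apply: sat_ExStr_action => ?; rewrite !satE.
Qed.

Lemma sat_succ_nz chi :
  sat succ_nz_formula chi s = forall x y, succ_at x y -> ~ zero_at y.
Proof. by do 2! apply: sat_AllStr_action => ?; rewrite !satE. Qed.

Lemma sat_succ_inj_fun chi : sat succ_inj_fun_formula chi s =
  forall x y x' y', succ_at x y -> succ_at x' y' ->
    (diag s x = diag s x' <-> diag s y = diag s y').
Proof. by do 4! apply: sat_AllStr_action => ?; rewrite !satE. Qed.

Lemma sat_succ_ext chi : sat succ_ext_formula chi s =
  forall x y x' y', succ_at x y -> diag s x = diag s x' -> diag s y = diag s y' ->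
    succ_at x' y'.
Proof. by do 4! apply: sat_AllStr_action => ?; rewrite !satE. Qed.

(** The formula quantifies over strategies, the right-hand side over predicates on states;
    comprehension turns a predicate into a strategy. *)
Lemma sat_induction chi : sat induction_formula chi s =
  forall P : St G -> Prop, (forall x, zero_at x -> P (diag s x)) ->
    (forall x y, succ_at x y -> P (diag s x) -> P (diag s y)) ->
    forall x, P (diag s x).
Proof.
have E f : sat (Imp (AllStr 0 (Imp (isZero 0) (member 0 2)))
    (Imp (AllStr 0 (AllStr 1 (Imp (isSucc 0 1) (Imp (member 0 2) (member 1 2)))))
      (AllStr 0 (member 0 2)))) (upd chi 2 f) s =
  ((forall x, zero_at x -> holds s f x) ->
   (forall x y, succ_at x y -> holds s f x -> holds s f y) ->
   forall x, holds s f x).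
  rewrite !sat_Imp; congr (_ -> _ -> _).
  - by apply: sat_AllStr_action => ?; rewrite !satE.
  - by do 2! apply: sat_AllStr_action => ?; rewrite !satE.
  - by apply: sat_AllStr_action => ?; rewrite !satE.
rewrite /induction_formula sat_AllStr; apply: propext; split=> [H P P0 PS x|H f].
  have [f fP] := comprehension P choice_s.
  have := H f; rewrite E => {}H; apply/fP; apply: H.
    by move=> y /P0 /fP.
  by move=> y z /PS yz /fP /yz /fP.
rewrite E => f0 fS x.
(* Conversely, membership respects equality of named states, so [f] induces a predicate on
   states. *)
have hE y : (exists z, diag s z = diag s y /\ holds s f z) <-> holds s f y.
  by split=> [[z [+ +]]|]; [apply: holds_diag | exists y].
apply/hE; apply: (H (fun t => exists z, diag s z = t /\ holds s f z)).
  by move=> y /f0 /hE.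
by move=> y z /fS yz /hE /yz /hE.
Qed.

Lemma sat_plus0 chi : sat plus0_formula chi s =
  forall x y z, zero_at y -> (plus_at x y z <-> diag s x = diag s z).
Proof. by do 3! apply: sat_AllStr_action => ?; rewrite !satE. Qed.

Lemma sat_times0 chi : sat times0_formula chi s =
  forall x y z, zero_at y -> (times_at x y z <-> zero_at z).
Proof. by do 3! apply: sat_AllStr_action => ?; rewrite !satE. Qed.

Lemma sat_plusS chi : sat plusS_formula chi s =
  forall x y y' z', succ_at y y' ->
    (plus_at x y' z' <-> exists z, plus_at x y z /\ succ_at z z').
Proof.
do 4! apply: sat_AllStr_action => ?; rewrite !satE.
congr (_ -> (_ <-> _)); apply: sat_ExStr_action => ?; by rewrite !satE.
Qed.

Lemma sat_timesS chi : sat timesS_formula chi s =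
  forall x y y' z', succ_at y y' ->
    (times_at x y' z' <-> exists z, times_at x y z /\ plus_at z x z').
Proof.
do 4! apply: sat_AllStr_action => ?; rewrite !satE.
congr (_ -> (_ <-> _)); apply: sat_ExStr_action => ?; by rewrite !satE.
Qed.

(** * Correctness of the translation over standard numbers *)

Variables (num : Ac G -> nat)
  (num_s : standard (diag s) zero_at succ_at plus_at times_at num).

Lemma numv_tmpv x d : (numv x == tmpv d) = false.
Proof. by apply/eqP; rewrite /numv /tmpv; lia. Qed.
Lemma setv_tmpv x d : (setv x == tmpv d) = false.
Proof. by apply/eqP; rewrite /setv /tmpv; lia. Qed.
Lemma numv_setv x X : (numv x == setv X) = false.
Proof. by apply/eqP; rewrite /numv /setv; lia. Qed.
Lemma numv_inj x y : (numv x == numv y) = (x == y).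
Proof. by rewrite /numv eqn_mul2l. Qed.
Lemma setv_inj x y : (setv x == setv y) = (x == y).
Proof. by rewrite /setv eqSS eqn_mul2l. Qed.
Lemma tmpv_inj x y : (tmpv x == tmpv y) = (x == y).
Proof. by rewrite /tmpv !eqSS eqn_mul2l. Qed.
Lemma neqSn d : (d == d.+1) = false. Proof. by apply/eqP; lia. Qed.
Lemma neqSSn d : (d == d.+2) = false. Proof. by apply/eqP; lia. Qed.

Let varE := (numv_tmpv, setv_tmpv, numv_setv, numv_inj, setv_inj, tmpv_inj, neqSn,
  neqSSn, eqxx).

Definition num_env chi (e : nat -> nat) :=
  forall x, num (action_of chi s (numv x)) = e x.

Lemma num_env_upd chi e d g : num_env chi e -> num_env (upd chi (tmpv d) g) e.
Proof. by move=> env x; rewrite action_of_upd varE. Qed.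

Definition value_spec t := forall d chi e, num_env chi e ->
  sat (value t d) chi s <-> num (action_of chi s (tmpv d)) = teval e t.

(** The common shape of translated atoms and compound terms. Taking [value_spec t] as a hypothesis
    makes it usable inside the induction on terms. *)
Lemma sat_exists_value t f d chi e : value_spec t -> num_env chi e ->
  sat (ExStr (tmpv d) (And (value t d) f)) chi s <->
  exists2 g, num (g (track1 s)) = teval e t & sat f (upd chi (tmpv d) g) s.
Proof.
move=> tP env; rewrite sat_ExStr; split=> -[g].
  rewrite sat_And (tP _ _ _ (num_env_upd _ _ env)) action_of_upd eqxx => -[]; by exists g.
move=> gt fg; exists g; rewrite sat_And (tP _ _ _ (num_env_upd _ _ env)).
by rewrite action_of_upd eqxx.
Qed.

Lemma strategy_surj k : exists g : strategy G, num (g (track1 s)) = k.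
Proof. by have [n <-] := num_surj num_s k; exists (fun=> n). Qed.

Lemma sat_value t : value_spec t.
Proof.
elim: t => [x|||t1 IH1 t2 IH2|t1 IH1 t2 IH2] d chi e env.
- by rewrite satE (num_eq num_s) env /=; split=> ->.
- by rewrite satE (num_zero num_s).
- rewrite [value _ _]/= sat_ExStr; split=> [[g]|].
    by rewrite !satE !varE (num_zero num_s) (num_succ num_s) => -[->].
  have [g g0] := strategy_surj 0; exists g.
  by rewrite !satE !varE (num_zero num_s) (num_succ num_s) g0.
- rewrite [value _ _]/= (sat_exists_value _ _ IH1 env); split=> [[g gt]|].
    rewrite (sat_exists_value _ _ IH2 (num_env_upd _ _ env)) => -[h ht].
    by rewrite !satE !varE (num_plus num_s) gt ht.
  move=> dt; have [g gt] := strategy_surj (teval e t1); exists g => //.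
  rewrite (sat_exists_value _ _ IH2 (num_env_upd _ _ env)).
  have [h ht] := strategy_surj (teval e t2); exists h => //.
  by rewrite !satE !varE (num_plus num_s) gt ht.
- rewrite [value _ _]/= (sat_exists_value _ _ IH1 env); split=> [[g gt]|].
    rewrite (sat_exists_value _ _ IH2 (num_env_upd _ _ env)) => -[h ht].
    by rewrite !satE !varE (num_times num_s) gt ht.
  move=> dt; have [g gt] := strategy_surj (teval e t1); exists g => //.
  rewrite (sat_exists_value _ _ IH2 (num_env_upd _ _ env)).
  have [h ht] := strategy_surj (teval e t2); exists h => //.
  by rewrite !satE !varE (num_times num_s) gt ht.
Qed.

Definition set_env chi (V : nat -> nat -> Prop) :=
  forall X n, V X (num n) <-> holds s (strategy_of chi (setv X)) n.

(** Comprehension for the states that name a member of [S]; by [num_eq] such a state names a single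
    number. *)
Lemma strategy_of_set (S : nat -> Prop) :
  exists f, forall n, S (num n) <-> holds s f n.
Proof.
have [f fP] := comprehension (fun t => exists2 n, t = diag s n & S (num n)) choice_s.
exists f => n; rewrite fP; split=> [|[m /(num_eq num_s) ->]] //; by exists n.
Qed.

Lemma set_of_strategy (f : strategy G) :
  exists S : nat -> Prop, forall n, S (num n) <-> holds s f n.
Proof.
exists (fun k => exists2 n, num n = k & holds s f n) => n.
by split=> [[m /(num_eq num_s)]|]; [apply: holds_diag | exists n].
Qed.

(** Induction on [psi]. Constant strategies supply numbers, and [strategy_of_set] and
    [set_of_strategy] exchange sets with strategies. As [numv] and [setv] have disjoint ranges, an
    update of one sort leaves the environment of the other intact. *)
Lemma sat_translation psi e V chi : num_env chi e -> set_env chi V ->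
  so_sat e V psi <-> sat (translation psi) chi s.
Proof.
have num_env_num chi' e' x g : num_env chi' e' ->
    num_env (upd chi' (numv x) g) [eta e' with x |-> num (g (track1 s))].
  by move=> env y; rewrite action_of_upd varE /=; case: eqP.
have set_env_num chi' V' x g : set_env chi' V' -> set_env (upd chi' (numv x) g) V'.
  by move=> env X n; rewrite strategy_of_upd eq_sym varE.
have num_env_set chi' e' X g : num_env chi' e' -> num_env (upd chi' (setv X) g) e'.
  by move=> env y; rewrite action_of_upd varE.
have set_env_set chi' V' X (S : nat -> Prop) g :
    set_env chi' V' -> (forall n, S (num n) <-> holds s g n) ->
    set_env (upd chi' (setv X) g) [eta V' with X |-> S].
  by move=> env SP Y n; rewrite strategy_of_upd varE /=; case: eqP.
elim: psi e V chi => [t1 t2|t1 t2|t X|f IH|f1 IH1 f2 IH2|f1 IH1 f2 IH2|x f IH|x f IH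
    |X f IH|X f IH] e V chi env envV; rewrite [so_sat _ _ _]/= [translation _]/=.
- rewrite (sat_exists_value _ _ (@sat_value t1) env); split=> [e12|[g gt]].
    have [g gt] := strategy_surj (teval e t1); exists g => //.
    by rewrite (sat_value _ _ (num_env_upd _ _ env)) satE varE gt.
  by rewrite (sat_value _ _ (num_env_upd _ _ env)) satE varE gt.
- rewrite (sat_exists_value _ _ (@sat_value t1) env); split=> [lt12|[g gt]].
    have [g gt] := strategy_surj (teval e t1); exists g => //.
    rewrite (sat_exists_value _ _ (@sat_value t2) (num_env_upd _ _ env)).
    have [h ht] := strategy_surj (teval e t2); exists h => //.
    (* The difference of the two values is the required nonzero summand. *)
    have [i it] := strategy_surj (teval e t2 - teval e t1); exists i.
    rewrite !satE !varE (num_zero num_s) (num_plus num_s) /= gt ht it; lia.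
  rewrite (sat_exists_value _ _ (@sat_value t2) (num_env_upd _ _ env)) => -[h ht].
  rewrite sat_ExStr => -[i].
  rewrite !satE !varE (num_zero num_s) (num_plus num_s) /= gt ht; lia.
- rewrite (sat_exists_value _ _ (@sat_value t) env); split=> [VX|[g gt]].
    have [g gt] := strategy_surj (teval e t); exists g => //.
    by rewrite !satE !varE -envV gt.
  by rewrite !satE !varE -envV gt.
- by rewrite sat_Neg (IH _ _ _ env envV).
- by rewrite sat_And (IH1 _ _ _ env envV) (IH2 _ _ _ env envV).
- by rewrite /= (IH1 _ _ _ env envV) (IH2 _ _ _ env envV).
- have IHx g := IH _ _ _ (num_env_num _ _ x g env) (set_env_num _ _ x g envV).
  rewrite sat_ExStr; split=> [[k]|[g /IHx]]; last by exists (num (g (track1 s))).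
  by have [g <-] := strategy_surj k => /IHx; exists g.
- have IHx g := IH _ _ _ (num_env_num _ _ x g env) (set_env_num _ _ x g envV).
  rewrite sat_AllStr; split=> [H g|H k]; first by apply/IHx.
  by have [g <-] := strategy_surj k; apply/IHx.
- have IHX S g gS := IH _ _ _ (num_env_set _ _ X g env) (set_env_set _ _ X S g envV gS).
  rewrite sat_ExStr; split=> [[S]|[g]].
    by have [g gS] := strategy_of_set S => /(IHX _ _ gS); exists g.
  by have [S gS] := set_of_strategy g => /(IHX _ _ gS); exists S.
- have IHX S g gS := IH _ _ _ (num_env_set _ _ X g env) (set_env_set _ _ X S g envV gS).
  rewrite sat_AllStr; split=> [H g|H S].
    by have [S gS] := set_of_strategy g; apply/(IHX _ _ gS).
  by have [g gS] := strategy_of_set S; apply/(IHX _ _ gS).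
Qed.

End Interpretation.

Lemma sat_axioms (G : cgs 'I_5 'I_3) (s : St G) (chi : assignment G) :
  sat axioms_formula chi s <-> choice_axiom s /\ arithmetic_at s.
Proof.
rewrite /axioms_formula sat_And sat_choice.
(* Several of the remaining readings presuppose the choice axiom, hence a congruence under that
   assumption. *)
have and_iff (A B C : Prop) : (A -> B <-> C) -> A /\ B <-> A /\ C by tauto.
apply: and_iff => cs; rewrite !sat_And sat_zero_ex sat_zero_un // sat_succ_ex sat_succ_nz.
rewrite sat_succ_inj_fun // sat_succ_ext // sat_induction // sat_plus0 // sat_plusS.
rewrite sat_times0 // sat_timesS; split=> [|[*]]; last by repeat apply: conj.
by case=> ? [? [? [? [? [? [? [? [? [? ?]]]]]]]]]; split.
Qed.

(** * The standard game *)

(** [None] is the initial state, [inl] records the three actions played there, and [inr] is the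
    answer to a membership test, positive when [ag0] plays 0. *)
Definition std_state : countType := option (nat * nat * nat + bool)%type.

Definition std_label (t : std_state) (p : 'I_5) : bool :=
  match t, val p with
  | Some (inr b), 0 => b
  | Some (inl (x, _, _)), 1 => x == 0
  | Some (inl (x, y, _)), 2 => y == x.+1
  | Some (inl (x, y, z)), 3 => x + y == z
  | Some (inl (x, y, z)), 4 => x * y == z
  | _, _ => false
  end.

Definition std_trans (t : std_state) (d : {ffun 'I_3 -> nat}) : std_state :=
  match t with
  | None => Some (inl (d ag0, d ag1, d ag2))
  | Some (inl _) => Some (inr (d ag0 == 0))
  | Some (inr b) => Some (inr b)
  end.

Definition std_game : cgs 'I_5 'I_3 :=
  @CGS 'I_5 'I_3 nat std_state 0 (fun t => [set p | std_label t p]) std_trans None.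

Lemma std_standard : standard (@diag std_game None) (@zero_at std_game None)
  (@succ_at std_game None) (@plus_at std_game None) (@times_at std_game None) id.
Proof.
split=> [k|x y|x|x y|x y z|x y z]; rewrite /zero_at /succ_at /plus_at /times_at /diag
  /next_state /decision ?inE /std_label /= ?ffunE //=.
- by exists k.
- by split=> [[]|->].
all: by split=> /eqP.
Qed.

Lemma std_choice : @choice_axiom std_game None.
Proof.
move=> n; rewrite /diag /next_state /decision.
by split; [exists 0 | exists 1]; rewrite inE /std_label /= !ffunE.
Qed.

(** * Closure properties of recursive functions *)

Lemma recursive_const n c : recursive (fun _ : n.-tuple nat => c).
Proof.
elim: c => [|c IH]; first exact: rec_zero.
apply: rec_ext (rec_comp (g := fun _ : 'I_1 => fun=> c) rec_succ (fun=> IH)) => v.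
by rewrite /thead tnth_mktuple.
Qed.

Lemma recursive_comp2 n (h : nat -> nat -> nat) (f g : n.-tuple nat -> nat) :
  recursive (fun v : 2.-tuple nat => h (tnth v ord0) (tnth v ord_max)) ->
  recursive f -> recursive g -> recursive (fun v => h (f v) (g v)).
Proof.
move=> rh rf rg.
have r (i : 'I_2) : recursive (if i == ord0 then f else g) by case: ifP.
apply: (rec_ext _ (rec_comp (g := fun i => if i == ord0 then f else g) rh r)) => v.
  by rewrite !tnth_mktuple.
Qed.

Lemma recursive_succ n (f : n.-tuple nat -> nat) :
  recursive f -> recursive (fun v => (f v).+1).
Proof.
move=> rf; apply: rec_ext (rec_comp (g := fun _ : 'I_1 => f) rec_succ (fun=> rf)) => v.
by rewrite /thead tnth_mktuple.
Qed.

Lemma recursive_add n (f g : n.-tuple nat -> nat) :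
  recursive f -> recursive g -> recursive (fun v => f v + g v).
Proof.
apply: recursive_comp2.
(* The step function receives the counter, the previous value and the parameter, in this order;
   index 1 is the previous value. *)
apply: rec_ext (rec_prim (n := 1) (rec_proj ord0)
  (recursive_succ (rec_proj (@Ordinal 3 1 isT)))) => v.
rewrite [tnth v ord0](_ : _ = thead v) //.
rewrite (_ : tnth v ord_max = tnth [tuple of behead v] ord0); last first.
  by rewrite !(tnth_nth 0) nth_behead.
by elim: (thead v) => //= k ->; rewrite addSn.
Qed.

(** Pascal's rule gives $\binom{k+2}{2}=\binom{k+1}{2}+(k+1)$, a primitive recursion using only
    addition. *)
Lemma recursive_bin2 n (f : n.-tuple nat -> nat) :
  recursive f -> recursive (fun v => 'C((f v).+1, 2)).
Proof.
move=> rf.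
have r : recursive (fun v : 1.-tuple nat => 'C((thead v).+1, 2)).
  apply: rec_ext (rec_prim (n := 0) (rec_zero 0)
    (recursive_add (rec_proj (@Ordinal 2 1 isT)) (recursive_succ (rec_proj ord0)))) => v.
  elim: (thead v) => //= k ->.
  by rewrite !(tnth_nth 0) /= [RHS]binS bin1.
apply: rec_ext (rec_comp (g := fun _ : 'I_1 => f) r (fun=> rf)) => v.
by rewrite /thead tnth_mktuple.
Qed.

Lemma computable_cpair f g :
  computable f -> computable g -> computable (fun n => cpair (f n) (g n)).
Proof.
move=> rf rg; rewrite /computable /cpair.
exact: recursive_add (recursive_bin2 (recursive_add rf rg)) rg.
Qed.

Lemma computable_const c : computable (fun=> c).
Proof. exact: recursive_const. Qed.

Lemma computable_id : computable id.
Proof. by apply: rec_ext (rec_proj ord0) => v. Qed.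

(** Primitive recursion whose step ignores the counter; it serves to code [n] nested copies of a
    formula. *)
Lemma computable_iter h c : computable h -> computable (fun n => iter n h c).
Proof.
move=> rh.
have r : recursive (fun v : 2.-tuple nat => h (tnth v (@Ordinal 2 1 isT))).
  apply: rec_ext (rec_comp (g := fun (_ : 'I_1) (v : 2.-tuple nat) =>
    tnth v (@Ordinal 2 1 isT)) rh (fun=> rec_proj _)) => v.
  by rewrite /thead tnth_mktuple.
apply: rec_ext (rec_prim (n := 0) (recursive_const 0 c) r) => v.
by elim: (thead v) => //= k ->; rewrite (tnth_nth 0).
Qed.

(** * Free agents, free variables and closure into sentences *)

Definition agentless (f : formula) := forall a, free f (inl a) = false.

(** Temporal operators make all agents free, but [joint] binds all three of them around its
    [Next]. *)
Lemma agentless_joint x y z f : agentless (joint x y z f).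
Proof. by case=> [[|[|[|i]]] hi]. Qed.

Lemma agentless_And f1 f2 : agentless f1 -> agentless f2 -> agentless (And f1 f2).
Proof. by move=> h1 h2 a /=; rewrite h1 h2. Qed.

Lemma agentless_ExStr x f : agentless f -> agentless (ExStr x f).
Proof. by move=> h a /=; rewrite h. Qed.

Lemma agentless_sameNum x y : agentless (sameNum x y).
Proof. by case=> [[|[|[|i]]] hi]. Qed.

Lemma agentless_axioms : agentless axioms_formula.
Proof. by case=> [[|[|[|i]]] hi]. Qed.

Lemma agentless_value t d : agentless (value t d).
Proof.
elim: t d => [x|||t1 IH1 t2 IH2|t1 IH1 t2 IH2] d /=; last 2 first.
- do 2! (apply: agentless_ExStr; apply: agentless_And => //).
  exact: agentless_joint.
- do 2! (apply: agentless_ExStr; apply: agentless_And => //).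
  exact: agentless_joint.
- exact: agentless_sameNum.
- exact: agentless_joint.
- by apply: agentless_ExStr; apply: agentless_And; apply: agentless_joint.
Qed.

Lemma agentless_translation psi : agentless (translation psi).
Proof.
have ExV t d f : agentless f -> agentless (ExStr (tmpv d) (And (value t d) f)).
  by move=> af; apply/agentless_ExStr/agentless_And => //; apply: agentless_value.
elim: psi => [t1 t2|t1 t2|t X|f IH|f1 IH1 f2 IH2|f1 IH1 f2 IH2|x f IH|x f IH
    |X f IH|X f IH].
- exact/ExV/agentless_value.
- apply/ExV/ExV/agentless_ExStr/agentless_And; last exact: agentless_joint.
  by case=> [[|[|[|i]]] hi].
- exact/ExV/agentless_joint.
all: by move=> a; rewrite /= ?IH ?IH1 ?IH2.
Qed.

Definition bounded B (f : formula) := forall v, free f (inr v) -> v < B.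

Lemma boundedW B B' f : B <= B' -> bounded B f -> bounded B' f.
Proof. by move=> le bf v /bf lt; apply: leq_trans le. Qed.

Lemma bounded_ex f : exists B, bounded B f.
Proof.
elim: f => [p|f [B IH]|f1 [B1 IH1] f2 [B2 IH2]|f1 [B1 IH1] f2 [B2 IH2]|f [B IH]
  |f1 [B1 IH1] f2 [B2 IH2]|f1 [B1 IH1] f2 [B2 IH2]|x f [B IH]|x f [B IH]|a x f [B IH]].
- by exists 0.
- by exists B.
- by exists (B1 + B2) => v /= /orP [/IH1|/IH2]; lia.
- by exists (B1 + B2) => v /= /orP [/IH1|/IH2]; lia.
- by exists B.
- by exists (B1 + B2) => v /= /orP [/IH1|/IH2]; lia.
- by exists (B1 + B2) => v /= /orP [/IH1|/IH2]; lia.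
- by exists B => v /= /andP [/IH].
- by exists B => v /= /andP [/IH].
- exists (B + x.+1) => v /=; case: ifP => _; last by move/IH; lia.
  by rewrite andbT => /orP [/IH|/eqP [->]]; lia.
Qed.

(** Meant for formulas whose remaining free variables do not affect their truth, so that existential
    closure is harmless. *)
Definition closure B (f : formula) : formula := foldr (@ExStr _ _) f (iota 0 B).

Lemma sentence_closure B f : agentless f -> bounded B f -> sentence (closure B f).
Proof.
move=> agf bf l; rewrite /closure.
have -> (r : seq nat) : free (foldr (@ExStr _ _) f r) l =
    free f l && (if l is inr v then v \notin r else true).
  elim: r => [|x r /= ->]; first by case: l => * /=; rewrite andbT.
  case: l => [a|v]; rewrite ?andbT // in_cons (inj_eq inr_inj) negb_or.
  by rewrite -andbA [X in _ && X]andbC.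
case: l => [a|v]; first by rewrite agf.
by apply/negP => /andP [/bf lt]; rewrite mem_iota lt.
Qed.

Lemma sat_closure_intro G B f (chi : assignment G) s :
  (forall chi, sat f chi s) -> sat (closure B f) chi s.
Proof.
move=> H; rewrite /closure; elim: (iota 0 B) chi => [|x r IH] chi //.
by rewrite [foldr _ _ _]/= sat_ExStr; exists (fun=> ac0 G).
Qed.

Lemma sat_closure_elim G B f (chi : assignment G) s :
  sat (closure B f) chi s -> exists chi', sat f chi' s.
Proof.
rewrite /closure; elim: (iota 0 B) chi => [|x r IH] chi; first by exists chi.
by rewrite [foldr _ _ _]/= sat_ExStr => -[g /IH].
Qed.

(** * Numerals and the instances of the reduction *)

Definition add_one : so := SoEq (Var 1) (Add (Var 0) One).
Definition copy_back : so := SoEq (Var 0) (Var 1).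
(* Only [Var 0] is meaningful in psi, so [Var 1] may be overwritten. *)
Definition increment (psi : so) : so :=
  SoExNum 1 (SoAnd add_one (SoExNum 0 (SoAnd copy_back psi))).
Definition at_numeral (psi : so) (n : nat) : so :=
  SoExNum 0 (SoAnd (SoEq (Var 0) Zero) (iter n increment psi)).

Lemma so_sat_at_numeral (A : nat -> Prop) psi :
  (forall e V, A (e 0) <-> so_sat e V psi) ->
  forall n e V, A n <-> so_sat e V (at_numeral psi n).
Proof.
move=> Apsi n e V.
(* Each increment adds one to variable 0. It also changes variable 1, which is harmless because
   [Apsi] holds for all valuations. *)
have E m e' V' : A (e' 0 + m) <-> so_sat e' V' (iter m increment psi).
  elim: m e' V' => [|m IH] e' V'; first by rewrite addn0.
  rewrite addnS -addSn -addn1 /=; split=> [H|[_ [-> [_ [-> /IH]]]]] //.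
  by exists (e' 0 + 1); split=> //; exists (e' 0 + 1); split=> //; apply/IH.
rewrite /=; split=> [An|[_ [-> /E]]] //.
by exists 0; split=> //; apply/E.
Qed.

Definition instance B psi n : formula :=
  closure B (And axioms_formula (translation (at_numeral psi n))).

(** One bound serves every [n], since all increments reuse the same variables; the number of closing
    quantifiers is therefore constant. *)
Lemma sentence_instance psi : exists B, forall n, sentence (instance B psi n).
Proof.
have [B1 b1] := bounded_ex (translation add_one).
have [B2 b2] := bounded_ex (translation copy_back).
have [B3 b3] := bounded_ex (translation psi).
have [B4 b4] := bounded_ex (translation (SoEq (Var 0) Zero)).
have [B5 b5] := bounded_ex axioms_formula.
pose B := B1 + B2 + B3 + B4 + B5; exists B => n.
apply: sentence_closure.
  by apply: agentless_And; [exact: agentless_axioms | exact: agentless_translation].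
have bAnd f1 f2 : bounded B f1 -> bounded B f2 -> bounded B (And f1 f2).
  by move=> h1 h2 v /= /orP [/h1|/h2].
have bEx x f : bounded B f -> bounded B (ExStr x f).
  by move=> h v /= /andP [/h].
apply: (bAnd); first by apply: boundedW b5; lia.
apply/bEx/bAnd; first by apply: boundedW b4; lia.
elim: n => [|n IH]; first by apply: boundedW b3; lia.
apply/bEx/bAnd; first by apply: boundedW b1; lia.
by apply/bEx/bAnd => //; apply: boundedW b2; lia.
Qed.

Lemma sat_translation_at_numeral (A : nat -> Prop) psi n G (s : St G) chi num :
  (forall e V, A (e 0) <-> so_sat e V psi) ->
  choice_axiom s ->
  standard (diag s) (zero_at s) (succ_at s) (plus_at s) (times_at s) num ->
  A n <-> sat (translation (at_numeral psi n)) chi s.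
Proof.
move=> Apsi cs ns.
(* Both environments are read off from [chi], so no condition on [chi] is required. *)
pose e x := num (action_of chi s (numv x)).
have [V VP] := choice (fun X => set_of_strategy ns (strategy_of chi (setv X))).
by rewrite -(@sat_translation _ _ cs _ ns _ e V) //; apply: so_sat_at_numeral.
Qed.

(** A member [n] gives satisfaction in the standard game under every assignment. Conversely,
    categoricity makes the initial state of any model standard, where the translation is
    faithful. *)
Lemma satisfiable_instance (A : nat -> Prop) psi B n :
  (forall e V, A (e 0) <-> so_sat e V psi) ->
  A n <-> satisfiable (instance B psi n).
Proof.
move=> Apsi; split=> [An|[G]].
  exists std_game; apply: sat_closure_intro => chi; rewrite sat_And; split.
    apply/sat_axioms; split; first exact: std_choice.
    exact: standard_axioms std_standard.
  exact: (proj1 (sat_translation_at_numeral n chi Apsi std_choice std_standard)).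
case/sat_closure_elim => chi; rewrite sat_And sat_axioms => -[[cs /axioms_standard]].
by case=> num ns; apply: (proj2 (sat_translation_at_numeral n chi Apsi cs ns)).
Qed.

(** * Computability of the reduction and hardness *)

Lemma computable_cpair_const c f : computable f -> computable (fun n => cpair c (f n)).
Proof. exact: computable_cpair (computable_const c). Qed.

Lemma computable_code_And f (F : nat -> formula) :
  computable (fun n => code (F n)) -> computable (fun n => code (And f (F n))).
Proof. by move=> cF; do 2! apply: computable_cpair_const. Qed.

Lemma computable_code_ExStr x (F : nat -> formula) :
  computable (fun n => code (F n)) -> computable (fun n => code (ExStr x (F n))).
Proof. by move=> cF; do 2! apply: computable_cpair_const. Qed.

Lemma computable_code_instance B psi : computable (fun n => code (instance B psi n)).
Proof.
have c_iter : computable (fun n => code (translation (iter n increment psi))).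
  (* The effect of one increment on codes: 7 and 2 are the tags of [ExStr] and [And], while [a] and
     [b] stand for the codes of the translated [add_one] and [copy_back]. *)
  pose h a b c := cpair 7 (cpair (numv 1) (cpair 2 (cpair a
    (cpair 7 (cpair (numv 0) (cpair 2 (cpair b c))))))).
  have ch a b : computable (h a b).
    rewrite /h; do 8! apply: computable_cpair_const; exact: computable_id.
  (* Stated for arbitrary [c1] and [c2]: on the concrete ones, conversion tries to
     evaluate the codes, which are astronomically large. *)
  have hE c1 c2 f : code (translation (SoExNum 1 (SoAnd c1 (SoExNum 0 (SoAnd c2 f))))) =
      h (code (translation c1)) (code (translation c2)) (code (translation f)).
    by [].
  have [a [b {}hE]] : exists a b, forall f,
      code (translation (increment f)) = h a b (code (translation f)).
    exists (code (translation add_one)), (code (translation copy_back)).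
    exact: (hE add_one copy_back).
  have itE n : iter n (h a b) (code (translation psi)) =
      code (translation (iter n increment psi)).
    by elim: n => [//|n IH]; rewrite !iterS IH hE.
  exact: rec_ext (fun v => itE (thead v)) (computable_iter _ (ch a b)).
rewrite /instance /closure; elim: (iota 0 B) => [|x r IH].
  apply: computable_code_And; apply: computable_code_ExStr.
  exact: computable_code_And.
exact: computable_code_ExStr.
Qed.

Theorem theorem3p10 : Sigma11_hard SL_SAT.
Proof.
move=> A [psi _ Apsi]; have [B sB] := sentence_instance psi.
(* Since [SL_SAT] takes predecessors of sizes, 4 and 2 announce five propositions and three
   agents. *)
exists (fun n => cpair 4 (cpair 2 (code (instance B psi n)))); split.
  do 2! apply: computable_cpair (computable_const _) _.
  exact: computable_code_instance.
move=> n; rewrite (satisfiable_instance B n Apsi).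
(* Injectivity of [cpair] and [code] recovers the instance from its number. *)
split=> [sat_n|[p [g [phi [/cpair_inj [ep /cpair_inj [eg]]]]]]].
  by exists 4, 2, (instance B psi n).
by subst p g => /code_inj ->.
Qed.
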